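(* Let $s\in(0,1)$, $m\ge1$, $D\subset\mathbb{R}^n$ open and bounded, and suppose that $\Omega\subset D$ is a solution of $$\min\Big\{\sum_{i=1}^m\lambda_i^s(\tilde\Omega)+\Lambda\mathcal{L}_n(\tilde\Omega)\colon\tilde\Omega\subset D\ \text{$s$-quasi-open}\Big\}$$ for some $\Lambda>0$. Then the vector $V=(v^1,\dots,v^m)\in H^s_0(\Omega;\mathbb{R}^m)$ of the first $m$ normalized eigenfunctions on $\Omega$ satisfies the following almost-minimality condition: for every $\delta\ge\|V\|_{L^\infty(\Omega)}$ there exist $K,\varepsilon>0$ such that $$[V]^2_{H^s(\mathbb{R}^n)}+\Lambda\mathcal{L}_n(\{|V|>0\})\le\left(1+K\|\tilde V-V\|_{L^1(\mathbb{R}^n)}\right)[\tilde V]^2_{H^s(\mathbb{R}^n)}+\Lambda\mathcal{L}_n(\{|\tilde V|>0\})$$ for every $\tilde V\in H^s_0(D;\mathbb{R}^m)$ such that $\|\tilde V\|_{L^\infty(\mathbb{R}^n)}\le\delta$ and $\|V-\tilde V\|_{L^1(\mathbb{R}^n)}\le\varepsilon$.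
   Context: $\mathcal{L}_n$ is the Lebesgue measure on $\mathbb{R}^n$. A set $\Omega\subset\mathbb{R}^n$ is $s$-quasi-open if there is a decreasing sequence $\{\Omega_k\}$ of open sets such that $\Omega\cup\Omega_k$ is open and $\mathrm{cap}_s(\Omega_k)\to0$. For $\Omega$ bounded and $s$-quasi-open, $H^s_0(\Omega)$ is the set of functions in $H^s(\mathbb{R}^n)$ vanishing outside $\Omega$ up to a set of zero $s$-capacity; $[u]^2_{H^s(\mathbb{R}^n)}=\frac{C(n,s)}{2}\iint\frac{|u(x)-u(z)|^2}{|x-z|^{n+2s}}dx\,dz$ with $C(n,s)=\frac{2^{2s}s\Gamma(\frac n2+s)}{\pi^{n/2}\Gamma(1-s)}$; for vectors, $[V]^2_{H^s}=\sum_i[v^i]^2_{H^s}$ and $|V|$ is the Euclidean norm. $\lambda_i^s(\Omega)=\min_{E_i}\max_{u\in E_i\setminus\{0\}}[u]^2_{H^s}/\|u\|_{L^2}^2$ over $i$-dimensional subspaces $E_i\subset H^s_0(\Omega)$ (eigenvalues of $(-\Delta)^s$ with $v=0$ on $\mathbb{R}^n\setminus\Omega$). Normalized eigenfunctions $v^i$ are associated eigenfunctions, orthonormal in $L^2$. A shape optimizer is identified with $\{|V|>0\}$. *)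

(* Defs.v *)
From HB Require Import structures.
From mathcomp Require Import all_boot all_order all_algebra.
From mathcomp Require Import all_classical all_reals all_analysis.
From mathcomp Require Import lra.
Set Implicit Arguments.
Unset Strict Implicit.
Unset Printing Implicit Defensive.
Import Order.TTheory GRing.Theory Num.Theory.
Import numFieldNormedType.Exports.

Local Open Scope classical_set_scope.
Local Open Scope ring_scope.

Section box_outer_measure.
Context {R : realType} {n : nat}.
Local Notation rV := 'rV[R]_n.
Implicit Types (I : option (rV * rV)) (A : set rV).

(* [None] is the empty box: it makes finite covers available, and the empty
   cover in dimension 0, where every other box is the whole space. *)
Definition box I : set rV :=
  if I is Some (a, b) then [set x | forall i, a ord0 i < x ord0 i <= b ord0 i]
  else set0.

Definition box_volume I : R :=
  if I is Some (a, b) then \prod_i Num.max 0 (b ord0 i - a ord0 i) else 0.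

Definition lebesgue_outer A : \bar R :=
  ereal_inf [set (\sum_(k <oo) (box_volume (I k))%:E)%E | I in
    [set I : (option (rV * rV))^nat | A `<=` \bigcup_k box (I k)]].

Local Open Scope ereal_scope.

Lemma box_volume_ge0 I : 0 <= (box_volume I)%:E.
Proof.
rewrite lee_fin; case: I => [[a b]|]//=.
by apply: prodr_ge0 => i _; rewrite le_max lexx.
Qed.

Lemma lebesgue_outer_ge0 A : 0 <= lebesgue_outer A.
Proof.
apply: le_ereal_inf_tmp => x [I _ <-]; apply: nneseries_ge0 => k _ _.
exact: box_volume_ge0.
Qed.

Lemma lebesgue_outer0 : lebesgue_outer set0 = 0.
Proof.
apply/eqP; rewrite eq_le lebesgue_outer_ge0 andbT.
apply: ereal_inf_lbound; exists (fun=> None); first exact: sub0set.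
by rewrite eseries0.
Qed.

Lemma le_lebesgue_outer :
  {homo lebesgue_outer : A B / (A `<=` B)%classic >-> A <= B}.
Proof.
move=> A B AB; apply/ereal_inf_le_tmp => _ [I BI <-].
by exists I => //; exact: subset_trans AB BI.
Qed.

Lemma lebesgue_outer_sigma_subadditive : sigma_subadditive lebesgue_outer.
Proof.
move=> A; have [[i ioo]|] := pselect (exists i, lebesgue_outer (A i) = +oo).
  rewrite (eseries_pinfty _ _ ioo) ?leey// => k _.
  by rewrite -ltNye (lt_le_trans _ (lebesgue_outer_ge0 _)).
rewrite -forallNE => Aoo.
suff add2e (e : {posnum R}) : lebesgue_outer (\bigcup_n A n) <=
    \sum_(i <oo) lebesgue_outer (A i) + e%:num%:E.
  by apply/lee_addgt0Pr => _/posnumP[].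
rewrite (le_trans _ (epsilon_trick _ _ _))//; last first.
  by move=> k; exact: lebesgue_outer_ge0.
pose P k (I : (option (rV * rV))^nat) := (A k `<=` \bigcup_j box (I j))%classic /\
  \sum_(j <oo) (box_volume (I j))%:E <=
    lebesgue_outer (A k) + (e%:num / (2 ^ k.+1)%:R)%:E.
have [G PG] : {G : ((option (rV * rV))^nat)^nat & forall k, P k (G k)}.
  apply: (@choice _ _ P) => k; rewrite /P /lebesgue_outer.
  set S := (X in ereal_inf X); move infS : (ereal_inf S) => iS.
  case: iS infS => [r Sr|Soo|Soo].
  - have en1 : (0 < e%:num / (2 ^ k.+1)%:R)%R by [].
    have /(lb_ereal_inf_adherent en1) : ereal_inf S \is a fin_num by rewrite Sr.
    move=> [x [B AnB muBx] xS].
    by exists B; split => //; rewrite muBx -Sr; exact/ltW.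
  - by have := Aoo k; rewrite /lebesgue_outer Soo.
  - suff : lbound S 0 by move/le_ereal_inf_tmp; rewrite Soo.
    by move=> /= _ [B AnB <-]; apply: nneseries_ge0 => *; exact: box_volume_ge0.
pose w I := (box_volume I)%:E.
have muG_ge0 x : 0 <= (w \o uncurry G) x by exact: box_volume_ge0.
apply: (@le_trans _ _ (\esum_(i in setT) (w \o uncurry G) i)).
  apply: ereal_inf_lbound => /=.
  have /card_esym/ppcard_eqP[f] := card_nat2.
  exists (uncurry G \o f).
    apply: (@subset_trans _  (\bigcup_n \bigcup_k box (G n k))) => [t [i _]|].
      by have [+ _] := PG i => /[apply] -[j _ ?]; exists i => //; exists j.
    move=> t [i _ [j _ Bijt]]; exists (f^-1%FUN (i, j)) => //=.
    by rewrite invK ?inE.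
  rewrite -(esum_pred_image (w \o uncurry G) _ xpredT) ?[fun=> _]set_true//.
  by rewrite image_eq.
rewrite (_ : esum _ _ = \sum_(i <oo) \sum_(j <oo ) w (G i j)); last first.
  pose J : nat -> set (nat * nat) := fun i => [set (i, j) | j in setT]%classic.
  rewrite (_ : setT = \bigcup_k J k); last first.
    by rewrite predeqE => -[a b]; split => // _; exists a => //; exists b.
  rewrite esum_bigcupT /=; last 2 first.
    - apply/trivIsetP => i j _ _ ij.
      rewrite predeqE => -[p m] /=; split => //= -[] [_] _ [<-{p} _].
      by move=> [m' _] [] /esym/eqP; rewrite (negbTE ij).
    - by move=> /= [p m]; exact: box_volume_ge0.
  rewrite -(image_id [set: nat]) -fun_true esum_pred_image//; last first.
    by move=> p _; apply: esum_ge0 => *; exact: box_volume_ge0.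
  apply: eq_eseriesr => /= j _.
  rewrite -(esum_pred_image (w \o uncurry G) (pair j) predT)//=; last 2 first.
  - by move=> *; exact: box_volume_ge0.
  - by move=> ? ? _ _; exact: (@can_inj _ _ _ snd).
  by congr esum; rewrite predeqE => -[a b]; split; move=> [i _ <-]; exists i.
apply: lee_lim.
- apply: is_cvg_nneseries => p *.
  by apply: nneseries_ge0 => m *; exact: (muG_ge0 (p, m)).
- apply: is_cvg_nneseries => p *; apply: adde_ge0 => //.
  exact: lebesgue_outer_ge0.
- by near=> p; apply: lee_sum => i _; exact: (PG i).2.
Unshelve. all: by end_near. Qed.

HB.instance Definition _ := isOuterMeasure.Build R rV lebesgue_outer
  lebesgue_outer0 lebesgue_outer_ge0 le_lebesgue_outer
  lebesgue_outer_sigma_subadditive.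

Lemma lebesgue_outer_box I : lebesgue_outer (box I) <= (box_volume I)%:E.
Proof.
apply: ereal_inf_lbound; exists (fun k => if k == 0%N then I else None).
  by move=> x Ix; exists 0%N.
rewrite nneseries_recl//; last by move=> *; exact: box_volume_ge0.
by rewrite eseries_cond/= eseries0 ?adde0// => -[].
Qed.

Lemma caratheodory_halfspace (i : 'I_n) (c : R) :
  (lebesgue_outer.-caratheodory [set x : rV | c < x ord0 i]%R)%classic.
Proof.
set H := mkset _.
pose up I := if I is Some (a, b) then
  Some (\row_j (if j == i then Num.max (a ord0 i) c else a ord0 j), b)
  else None.
pose dn I := if I is Some (a, b) then
  Some (a, \row_j (if j == i then Num.min (b ord0 i) c else b ord0 j))
  else None.
have boxup I : (box I `&` H `<=` box (up I))%classic.
  case: I => [[a b]|] x [] //= Ix cx j; rewrite mxE.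
  have /andP[+ ->] := Ix j; rewrite andbT.
  by case: eqP => [->|_ ->//] ax; rewrite gt_max ax.
have boxdn I : (box I `&` ~` H `<=` box (dn I))%classic.
  case: I => [[a b]|] x [] //= Ix /negP; rewrite /= -leNgt => cx j; rewrite mxE.
  have /andP[-> xb] := Ix j.
  by case: eqP xb => [->|_ ->]// xb; rewrite le_min xb cx.
have vol I : ((box_volume I)%:E = (box_volume (up I))%:E + (box_volume (dn I))%:E).
  case: I => [[a b]|] /=; last by rewrite adde0.
  rewrite -EFinD; congr EFin.
  rewrite [LHS](bigD1 i)//= [X in (_ = X + _)%R](bigD1 i)//=.
  rewrite [X in (_ = _ + X)%R](bigD1 i)//=.
  rewrite !mxE eqxx.
  under [X in (_ = _ * X + _)%R]eq_bigr => j /negbTE ji do rewrite mxE ji.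
  under [X in (_ = _ + _ * X)%R]eq_bigr => j /negbTE ji do rewrite mxE ji.
  rewrite -mulrDl; congr (_ * _)%R.
  rewrite /Order.max /Order.min.
  case: (ltP (a ord0 i) c) => ?; case: (ltP (b ord0 i) c) => ?;
    by do ?[case: ltP => ?]; lra.
apply: le_caratheodory_measurable => X.
apply: le_ereal_inf_tmp => _ [I XI <-].
rewrite (eq_eseriesr (fun k _ => vol (I k))) nneseriesD//; last 2 first.
- by move=> *; exact: box_volume_ge0.
- by move=> *; exact: box_volume_ge0.
apply: leeD; apply: ereal_inf_lbound.
- exists (up \o I) => // x [/XI[k _ Ikx] Hx]; exists k => //=.
  exact: boxup.
- exists (dn \o I) => // x [/XI[k _ Ikx] Hx]; exists k => //=.
  exact: boxdn.
Qed.

End box_outer_measure.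

(* The topology and norm are those of row vectors (the norm is the sup norm, only
   used for boundedness; the Euclidean distance is [eucl_dist]); the sigma-algebra is
   the complete Lebesgue one. *)
Definition Rn (R : realType) (n : nat) : Type := 'rV[R]_n.

HB.instance Definition _ (R : realType) (n : nat) :=
  NormedModule.copy (Rn R n) 'rV[R]_n.
HB.instance Definition _ (R : realType) (n : nat) :=
  Measurable.copy (Rn R n) (caratheodory_type (@lebesgue_outer R n)).

Section lebesgue_Rn.
Context {R : realType} {n : nat}.

Definition leb : set (Rn R n) -> \bar R := @lebesgue_outer R n.

HB.instance Definition _ := isMeasure.Build _ (Rn R n) R leb
  (caratheodory_measure0 _) (@caratheodory_measure_ge0 _ _ _)
  (@caratheodory_measure_sigma_additive _ _ _).

Lemma measurable_box I : measurable (box I : set (Rn R n)).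
Proof.
case: I => [[a b]|]; last exact: measurable0.
have -> : box (Some (a, b)) = \bigcap_(i : 'I_n)
    ([set x : Rn R n | a ord0 i < x ord0 i] `&`
    ~` [set x : Rn R n | b ord0 i < x ord0 i]).
  apply/seteqP; split => x /=.
    by move=> abx i _; have /andP[? ?] := abx i; split => //; apply/negP; rewrite -leNgt.
  by move=> abx i; have [//|-> /negP] := abx i; rewrite -leNgt => ->.
apply: fin_bigcap_measurable; first exact: finite_finset.
move=> i _; apply: measurableI; first exact: caratheodory_halfspace.
by apply: measurableC; exact: caratheodory_halfspace.
Qed.

Lemma sigma_finite_leb : sigma_finite setT leb.
Proof.
exists (fun k => box (Some (const_mx (- k%:R), const_mx k%:R))).
  apply/esym/seteqP; split => // x _.
  pose M := \sum_i `|x ord0 i| + 1.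
  have [k Mk] : exists k, M < k%:R.
    by exists (Num.bound M); apply: archi_boundP; rewrite addr_ge0// sumr_ge0.
  exists k => //= i; rewrite !mxE.
  have : `|x ord0 i| < k%:R.
    apply: le_lt_trans Mk; rewrite /M (bigD1 i)//= -addrA lerDl addr_ge0//.
    by rewrite sumr_ge0.
  by rewrite ltr_norml => /andP[-> /ltW ->].
move=> k; split; first exact: measurable_box.
by apply: le_lt_trans (lebesgue_outer_box _) _; rewrite ltry.
Qed.

HB.instance Definition _ :=
  Measure_isSigmaFinite.Build _ _ _ leb sigma_finite_leb.

End lebesgue_Rn.

Section fractional_sobolev.
Context {R : realType} {n : nat}.
Variable s : R.
Local Notation E := (Rn R n).
Implicit Types (x z : E) (u v w phi : E -> R) (A U Omega D : set E).

Definition eucl_dist x z : R := Num.sqrt (\sum_i (x ord0 i - z ord0 i) ^+ 2).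

Definition Gamma_fun (a : R) : R :=
  \int[lebesgue_measure]_(t in `]0, +oo[) (t `^ (a - 1) * expR (- t)).

Definition frac_const : R :=
  2 `^ (2 * s) * s * Gamma_fun (n%:R / 2 + s) /
  (pi `^ (n%:R / 2) * Gamma_fun (1 - s)).

Definition ae0 u := {ae leb, forall x, u x = 0}.

Local Open Scope ereal_scope.

Definition L2_prod u v : \bar R := \int[leb]_x (u x * v x)%:E.

Definition L2_norm2 u : \bar R := \int[leb]_x (u x ^+ 2)%:E.

(* On the (null) diagonal the integrands below are 0 by the convention on
   inverses. *)
Definition Hs_seminorm2 u : \bar R :=
  (frac_const / 2)%:E * \int[leb \x leb]_p
    ((u p.1 - u p.2) ^+ 2 / eucl_dist p.1 p.2 `^ (n%:R + 2 * s))%:E.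

Definition Hs_form u v : \bar R :=
  (frac_const / 2)%:E * \int[leb \x leb]_p
    ((u p.1 - u p.2) * (v p.1 - v p.2) / eucl_dist p.1 p.2 `^ (n%:R + 2 * s))%:E.

Definition Hs : set (E -> R) := [set u |
  [/\ measurable_fun setT u, L2_norm2 u < +oo & Hs_seminorm2 u < +oo]].

(* The capacity of the full H^s norm; with the seminorm alone every bounded set
   would have zero capacity when n <= 2 s. *)
Definition cap A : \bar R :=
  ereal_inf [set Hs_seminorm2 u + L2_norm2 u | u in [set u | Hs u /\
    exists U, [/\ open U, (A `<=` U)%classic &
                  {ae leb, forall x, U x -> (1 <= u x)%R}]]].

Definition quasi_open Omega := exists O : (set E)^nat,
  [/\ forall k, open (O k), forall k, (O k.+1 `<=` O k)%classic,
      forall k, open (Omega `|` O k) & (cap \o O) @ \oo --> 0].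

Definition quasi_continuous w := forall e : R, (0 < e)%R ->
  exists U, [/\ open U, cap U < e%:E & {within ~` U, continuous w}].

(* Elements of H^s are represented by functions; the pointwise condition up to
   a set of zero capacity bears on a quasi-continuous representative. *)
Definition H0s Omega : set (E -> R) := [set u | Hs u /\
  exists w, [/\ quasi_continuous w, {ae leb, forall x, w x = u x} &
                cap [set x | ~ Omega x /\ w x <> 0%R] = 0]].

Definition lincomb k (e : 'I_k -> E -> R) (c : 'I_k -> R) : E -> R :=
  fun x => (\sum_j c j * e j x)%R.

(* [F] is the span of [k] functions that are independent modulo a.e. equality. *)
Definition subspace_of_dim k (F : set (E -> R)) :=
  exists e : 'I_k -> E -> R,
    (forall c, ae0 (lincomb e c) -> forall j, c j = 0%R) /\
    F = range (lincomb e).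

(* [fine] is harmless: both quantities are finite on H^s. *)
Definition rayleigh u : R := (fine (Hs_seminorm2 u) / fine (L2_norm2 u))%R.

(* [k] counts from 1; the value is +oo when H0s Omega has no [k]-dimensional
   subspace. *)
Definition lambda k Omega : \bar R :=
  ereal_inf [set ereal_sup [set (rayleigh u)%:E | u in F `\` ae0] |
    F in [set F | subspace_of_dim k F /\ (F `<=` H0s Omega)%classic]].

Definition objective m (L : R) Omega : \bar R :=
  \sum_(i < m) lambda i.+1 Omega + L%:E * leb Omega.

Definition shape_optimizer m (L : R) D Omega :=
  [/\ (Omega `<=` D)%classic, quasi_open Omega &
      forall Omega', (Omega' `<=` D)%classic -> quasi_open Omega' ->
        objective m L Omega <= objective m L Omega'].

Definition normalized_eigenfunctions m Omega (V : 'I_m -> E -> R) :=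
  [/\ forall i, H0s Omega (V i),
      forall i j, L2_prod (V i) (V j) = (i == j)%:R%:E &
      forall i phi, H0s Omega phi ->
        Hs_form (V i) phi = lambda i.+1 Omega * L2_prod (V i) phi].

Definition vnorm m (V : 'I_m -> E -> R) : E -> R :=
  fun x => Num.sqrt (\sum_i V i x ^+ 2)%R.

Definition Hs_vseminorm2 m (V : 'I_m -> E -> R) : \bar R :=
  \sum_i Hs_seminorm2 (V i).

End fractional_sobolev.

(* Main.v *)
Require Import Defs.
From HB Require Import structures.
From mathcomp Require Import all_boot all_order all_algebra.
From mathcomp Require Import all_classical all_reals all_analysis.
From mathcomp Require Import measurable_realfun ess_sup_inf ring lra.
Import Order.TTheory GRing.Theory Num.Theory.
Import numFieldNormedType.Exports.
Local Open Scope classical_set_scope.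
Local Open Scope ring_scope.
Local Open Scope ereal_scope.

(** The minimality of Omega is tested against the set Omega' where the
quasi-continuous representatives of the components of W do not all vanish.
It is quasi-open, and up to a null set it is the set where |W| > 0
([H0s_quasi_open_support]); the components of W belong to H^s_0(Omega').  As
the energy of V is the sum of the first m eigenvalues of Omega
([Hs_vseminorm2_eigenfunctions]), everything reduces to bounding the sum of
the eigenvalues of Omega' by a multiple, close to 1, of the energy of W.

W need not be orthonormal, but it nearly is: with M a common bound for |V| and
|W|, and t the L^1 norm of W - V, the identity
(c.V)^2 - (c.W)^2 = (c.(V - W)) (c.(V + W)) and the Cauchy-Schwarz inequality
give, for every vector c of coefficients,
||c.W||^2 >= ||c.V||^2 - 2 M t |c|^2 = (1 - 2 M t) |c|^2
([L2_norm2_lincomb_le], [L2_norm2_orthonormal]).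

If e_1, ..., e_k in H^s_0(Omega') satisfy ||c.e||^2 >= kappa |c|^2 with
kappa > 0, then the sum of the first k eigenvalues of Omega' is at most
kappa^-1 times the total energy of the family ([sum_lambda_le]).  This goes by
induction on k: some unit vector c maximizes the energy of c.e up to an error
eta, so that lambda_k is at most kappa^-1 ([c.e]^2 + eta).  The reflection of
R^k that exchanges c with the last basis vector turns e into a family with the
same total energy and the same lower bound, whose last member is c.e; the
induction hypothesis applies to the other members.  Near-maximizers suffice,
so neither compactness nor diagonalization is needed.

With kappa = 1 - 2 M t and t <= 1 / (4 M), kappa^-1 <= 1 + 4 M t, whence the
theorem with K = 4 M and eps = 1 / (4 M). *)

Set Implicit Arguments.
Unset Strict Implicit.
Unset Printing Implicit Defensive.

(** * Measurability *)

Section measurability.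
Context {R : realType} {n : nat}.
Local Notation E := (Rn R n).

Lemma measurable_coord (i : 'I_n) :
  measurable_fun [set: E] (fun x : E => x ord0 i).
Proof.
move=> _; apply: (measurability _ (RGenOInfty.measurableE R)) => //.
move=> _ [_ [c ->] <-]; rewrite setTI.
rewrite (_ : _ @^-1` _ = [set x : E | (c < x ord0 i)%R]).
  exact: caratheodory_halfspace.
by apply/seteqP; split => x /=; rewrite in_itv/= andbT.
Qed.

Lemma measurable_sqrt : measurable_fun setT (@Num.sqrt R).
Proof. by apply: continuous_measurable_fun; exact: sqrt_continuous. Qed.

Lemma measurable_eucl_dist :
  measurable_fun [set: E * E] (fun p => eucl_dist p.1 p.2).
Proof.
apply: measurableT_comp; first exact: measurable_sqrt.
apply: measurable_sum => i; apply: measurable_funX; apply: measurable_funB.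
- exact: (measurableT_comp (measurable_coord i) measurable_fst).
- exact: (measurableT_comp (measurable_coord i) measurable_snd).
Qed.

Lemma measurable_gagliardo (a : R) (u : E -> R) : measurable_fun setT u ->
  measurable_fun [set: E * E]
    (fun p => (u p.1 - u p.2) ^+ 2 / eucl_dist p.1 p.2 `^ a)%R.
Proof.
move=> mu; apply: measurable_funM.
  apply: measurable_funX; apply: measurable_funB.
  - exact: (measurableT_comp mu measurable_fst).
  - exact: (measurableT_comp mu measurable_snd).
under eq_fun do rewrite -powRN.
exact: (measurableT_comp (measurable_powR _) measurable_eucl_dist).
Qed.

Lemma measurable_vnorm m (V : 'I_m -> E -> R) :
  (forall i, measurable_fun setT (V i)) -> measurable_fun setT (vnorm V).
Proof.
move=> mV; apply: measurableT_comp; first exact: measurable_sqrt.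
by apply: measurable_sum => i; exact: measurable_funX.
Qed.

Lemma measurable_lincomb k (e : 'I_k -> E -> R) c :
  (forall i, measurable_fun setT (e i)) -> measurable_fun setT (lincomb e c).
Proof.
move=> me; apply: measurable_sum => i.
by apply: measurable_funM => //; exact: measurable_cst.
Qed.

End measurability.

(** * The Gagliardo seminorm *)

Section seminorm.
Context {R : realType} {n : nat}.
Variable s : R.
Hypothesis s_gt0 : (0 < s)%R.
Local Notation E := (Rn R n).

Lemma Gamma_fun_ge0 (a : R) : (0 <= Gamma_fun a)%R.
Proof.
apply: fine_ge0; apply: integral_ge0 => t _.
by rewrite lee_fin mulr_ge0 ?powR_ge0 ?expR_ge0.
Qed.

Lemma frac_const_ge0 : (0 <= @frac_const R n s)%R.
Proof.
by rewrite divr_ge0 ?mulr_ge0 ?powR_ge0 ?Gamma_fun_ge0 ?ltW.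
Qed.

Lemma Hs_seminorm2_ge0 (u : E -> R) : 0 <= Hs_seminorm2 s u.
Proof.
apply: mule_ge0; first by rewrite lee_fin divr_ge0 ?frac_const_ge0.
by apply: integral_ge0 => p _; rewrite lee_fin divr_ge0 ?sqr_ge0 ?powR_ge0.
Qed.

Lemma L2_norm2_ge0 (u : E -> R) : 0 <= L2_norm2 u.
Proof. by apply: integral_ge0 => x _; rewrite lee_fin sqr_ge0. Qed.

(** The total energy of a family as a single integral: a pointwise identity or
inequality between sums of squares passes to total energies. *)
Lemma sum_Hs_seminorm2 (I : finType) (u : I -> E -> R) :
  (forall i, measurable_fun setT (u i)) ->
  \sum_i Hs_seminorm2 s (u i) = (@frac_const R n s / 2)%:E *
    \int[leb \x leb]_p (\sum_i (u i p.1 - u i p.2) ^+ 2 /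
                          eucl_dist p.1 p.2 `^ (n%:R + 2 * s))%R%:E.
Proof.
move=> mu; rewrite -ge0_sume_distrr; last first.
  by move=> i _; apply: integral_ge0 => p _;
    rewrite lee_fin divr_ge0 ?sqr_ge0 ?powR_ge0.
congr (_ * _); under [RHS]eq_integral do rewrite -sumEFin.
rewrite ge0_integral_sum; first by [].
- exact: measurableT.
- by move=> i; apply/measurable_EFinP; exact: measurable_gagliardo.
- by move=> i p _; rewrite lee_fin divr_ge0 ?sqr_ge0 ?powR_ge0.
Qed.

Lemma le_sum_Hs_seminorm2 (I J : finType) (u : I -> E -> R) (v : J -> E -> R) :
  (forall i, measurable_fun setT (u i)) ->
  (forall j, measurable_fun setT (v j)) ->
  (forall x z, \sum_i (u i x - u i z) ^+ 2 <= \sum_j (v j x - v j z) ^+ 2)%R ->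
  \sum_i Hs_seminorm2 s (u i) <= \sum_j Hs_seminorm2 s (v j).
Proof.
move=> mu mv uv; rewrite !sum_Hs_seminorm2//.
apply: lee_wpmul2l; first by rewrite lee_fin divr_ge0 ?frac_const_ge0.
apply: ge0_le_integral.
- exact: measurableT.
- by move=> p _; rewrite lee_fin sumr_ge0// => i _;
    rewrite divr_ge0 ?sqr_ge0 ?powR_ge0.
- apply/measurable_EFinP; apply: measurable_sum => i.
  exact: measurable_gagliardo.
- apply/measurable_EFinP; apply: measurable_sum => i.
  exact: measurable_gagliardo.
- move=> p _; rewrite lee_fin -!mulr_suml ler_wpM2r ?invr_ge0 ?powR_ge0//.
Qed.

Lemma le_sum_L2_norm2 (I J : finType) (u : I -> E -> R) (v : J -> E -> R) :
  (forall i, measurable_fun setT (u i)) ->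
  (forall j, measurable_fun setT (v j)) ->
  (forall x, \sum_i u i x ^+ 2 <= \sum_j v j x ^+ 2)%R ->
  \sum_i L2_norm2 (u i) <= \sum_j L2_norm2 (v j).
Proof.
have sumE (K : finType) (w : K -> E -> R) :
    (forall i, measurable_fun setT (w i)) ->
    \sum_i L2_norm2 (w i) = \int[leb]_x (\sum_i w i x ^+ 2)%R%:E.
  move=> mw; under [RHS]eq_integral do rewrite -sumEFin.
  rewrite ge0_integral_sum; first by [].
  - exact: measurableT.
  - by move=> i; apply/measurable_EFinP; exact: measurable_funX.
  - by move=> i p _; rewrite lee_fin sqr_ge0.
move=> mu mv uv; rewrite !sumE//.
apply: ge0_le_integral.
- exact: measurableT.
- by move=> p _; rewrite lee_fin sumr_ge0// => i _; rewrite sqr_ge0.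
- apply/measurable_EFinP; apply: measurable_sum => i; exact: measurable_funX.
- apply/measurable_EFinP; apply: measurable_sum => i; exact: measurable_funX.
- by move=> p _; rewrite lee_fin.
Qed.

Lemma Hs_seminorm2Z (a : R) (u : E -> R) : measurable_fun setT u ->
  Hs_seminorm2 s (fun x => a * u x)%R = (a ^+ 2)%:E * Hs_seminorm2 s u.
Proof.
move=> mu; rewrite /Hs_seminorm2 muleCA; congr (_ * _).
rewrite -ge0_integralZl//.
- by apply: eq_integral => p _; rewrite -EFinM -mulrBr exprMn -mulrA.
- by apply/measurable_EFinP; exact: measurable_gagliardo.
- by move=> p _; rewrite lee_fin divr_ge0 ?sqr_ge0 ?powR_ge0.
- by rewrite lee_fin sqr_ge0.
Qed.

End seminorm.

(** * Null sets and capacity *)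

Section null_sets.
Context {R : realType} {n : nat}.
Local Notation E := (Rn R n).

Lemma ae_leb_eq0 (P : set E) : {ae leb, forall x, P x} -> leb (~` P) = 0.
Proof.
move=> [N [mN N0 PN]]; apply/eqP; rewrite eq_le lebesgue_outer_ge0 andbT.
by rewrite -N0; exact: le_lebesgue_outer.
Qed.

(** [leb] is an outer measure, defined on all sets; a set where it vanishes is
automatically measurable. *)
Lemma leb0_negligible (A : set E) : leb A = 0 -> (@leb R n).-negligible A.
Proof.
move=> A0; exists A; split => //; apply: le_caratheodory_measurable => X.
rewrite [X in X + _](_ : _ = 0).
  by rewrite add0e; apply: le_lebesgue_outer; exact: subIsetl.
apply/eqP; rewrite eq_le lebesgue_outer_ge0 andbT.
by rewrite -[leRHS]A0; apply: le_lebesgue_outer; exact: subIsetr.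
Qed.

Lemma le_leb_ae (A B : set E) : {ae leb, forall x, A x -> B x} ->
  leb A <= leb B.
Proof.
move=> /ae_leb_eq0 AB0; set N := ~` _ in AB0.
apply: (@le_trans _ _ (leb (B `|` N))).
  apply: le_lebesgue_outer => x Ax.
  by have [Bx|Bx] := pselect (B x); [left|right => /(_ Ax)].
apply: le_trans (outer_measureU2 _ _ _) _.
by rewrite [X in _ + X]AB0 adde0.
Qed.

End null_sets.

Lemma sqr_maxB_le (R : realDomainType) (a b c d : R) :
  ((Num.max a b - Num.max c d) ^+ 2 <= (a - c) ^+ 2 + (b - d) ^+ 2)%R.
Proof.
have sqr_le (x y z : R) : (x <= y <= z)%R ->
    (y ^+ 2 <= x ^+ 2 + z ^+ 2)%R
  by move=> /andP[xy yz]; case: (lerP 0 y) => y0; nra.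
case: (leP a b) => ab; case: (leP c d) => cd.
- by rewrite lerDr sqr_ge0.
- by apply: sqr_le; rewrite lerD2r ab/= lerD2l lerN2 ltW.
- by rewrite [leRHS]addrC; apply: sqr_le; rewrite lerD2r (ltW ab)/= lerD2l lerN2.
- by rewrite lerDl sqr_ge0.
Qed.

Lemma sqrD_le (R : realDomainType) (a b : R) :
  ((a + b) ^+ 2 <= (2 * a) ^+ 2 + (2 * b) ^+ 2)%R.
Proof.
rewrite -subr_ge0 (_ : _ - _ = (a - b) ^+ 2 + 2 * a ^+ 2 + 2 * b ^+ 2)%R; last ring.
by do 2?[apply: addr_ge0]; rewrite ?sqr_ge0// pmulr_rge0 ?ltr0n ?sqr_ge0.
Qed.

Section capacity.
Context {R : realType} {n : nat}.
Variable s : R.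
Hypothesis s_gt0 : (0 < s)%R.
Local Notation E := (Rn R n).
Implicit Types (A B : set E) (u v w : E -> R).

Lemma Hs_seminorm2_leD u v w :
  measurable_fun setT u -> measurable_fun setT v -> measurable_fun setT w ->
  (forall x z, (u x - u z) ^+ 2 <= (v x - v z) ^+ 2 + (w x - w z) ^+ 2)%R ->
  Hs_seminorm2 s u <= Hs_seminorm2 s v + Hs_seminorm2 s w.
Proof.
move=> mu mv mw uvw.
have := @le_sum_Hs_seminorm2 R n s s_gt0 'I_1 bool (fun=> u)
  (fun b => if b then v else w).
rewrite big_ord1 big_bool/=; apply => //; first by case.
by move=> x z; rewrite big_ord1 big_bool.
Qed.

Lemma L2_norm2_leD u v w :
  measurable_fun setT u -> measurable_fun setT v -> measurable_fun setT w ->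
  (forall x, u x ^+ 2 <= v x ^+ 2 + w x ^+ 2)%R ->
  L2_norm2 u <= L2_norm2 v + L2_norm2 w.
Proof.
move=> mu mv mw uvw.
have := @le_sum_L2_norm2 R n 'I_1 bool (fun=> u)
  (fun b => if b then v else w).
rewrite big_ord1 big_bool/=; apply => //; first by case.
by move=> x; rewrite big_ord1 big_bool.
Qed.

Lemma L2_norm2Z (a : R) u : measurable_fun setT u ->
  L2_norm2 (fun x => a * u x)%R = (a ^+ 2)%:E * L2_norm2 u.
Proof.
move=> mu; rewrite /L2_norm2 -ge0_integralZl.
- by apply: eq_integral => p _; rewrite -EFinM exprMn.
- exact: measurableT.
- by apply/measurable_EFinP; exact: measurable_funX.
- by move=> p _; rewrite lee_fin sqr_ge0.
- by rewrite lee_fin sqr_ge0.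
Qed.

Lemma HsZ (a : R) u : Hs s u -> Hs s (fun x => a * u x)%R.
Proof.
move=> [mu u2 us]; split.
- by apply: measurable_funM => //; exact: measurable_cst.
- by rewrite L2_norm2Z// lte_mul_pinfty// lee_fin sqr_ge0.
- by rewrite Hs_seminorm2Z// lte_mul_pinfty// lee_fin sqr_ge0.
Qed.

Lemma Hs_leD u v w : measurable_fun setT u -> Hs s v -> Hs s w ->
  (forall x, u x ^+ 2 <= v x ^+ 2 + w x ^+ 2)%R ->
  (forall x z, (u x - u z) ^+ 2 <= (v x - v z) ^+ 2 + (w x - w z) ^+ 2)%R ->
  Hs s u.
Proof.
move=> mu [mv v2 vs] [mw w2 ws] uvw uvw2; split => //.
  apply: le_lt_trans (L2_norm2_leD mu mv mw uvw) _; exact: lte_add_pinfty.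
apply: le_lt_trans (Hs_seminorm2_leD mu mv mw uvw2) _; exact: lte_add_pinfty.
Qed.

Lemma HsD u v : Hs s u -> Hs s v -> Hs s (fun x => u x + v x)%R.
Proof.
move=> hu hv; apply: (Hs_leD _ (HsZ 2 hu) (HsZ 2 hv)).
- by apply: measurable_funD; [case: hu|case: hv].
- by move=> x; exact: sqrD_le.
- by move=> x z; rewrite opprD addrACA -!mulrBr; exact: sqrD_le.
Qed.

Lemma Hs0 : Hs s (fun _ : E => 0%R).
Proof.
split; first exact: measurable_cst.
- by rewrite /L2_norm2; under eq_integral do rewrite expr0n/=; rewrite integral0.
- rewrite /Hs_seminorm2; under eq_integral do rewrite subr0 expr0n/= mul0r.
  by rewrite integral0 mule0.
Qed.

Lemma cap_ge0 A : 0 <= cap s A.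
Proof.
by apply: le_ereal_inf_tmp => _ [u _ <-]; rewrite adde_ge0 ?Hs_seminorm2_ge0 ?L2_norm2_ge0.
Qed.

Lemma le_cap A B : A `<=` B -> cap s A <= cap s B.
Proof.
move=> AB; apply: ereal_inf_le_tmp => _ [u [hu [U [oU BU uU]]] <-].
by exists u => //; split => //; exists U; split => //; exact: subset_trans BU.
Qed.

Lemma cap_set0 : cap s (set0 : set E) = 0.
Proof.
apply/eqP; rewrite eq_le cap_ge0 andbT; apply: ereal_inf_lbound.
exists (fun=> 0%R).
  split; first exact: Hs0.
  by exists set0; split; [exact: open0|exact: subset_refl|exact: nearW].
rewrite /Hs_seminorm2 /L2_norm2.
under eq_integral do rewrite subr0 expr0n/= mul0r.
by rewrite integral0 mule0; under eq_integral do rewrite expr0n/=; rewrite integral0 adde0.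
Qed.

(** Finite subadditivity of the capacity: the pointwise maximum of competitors
for A and B is a competitor for their union. *)
Lemma capU_lt A B (a b : R) : cap s A < a%:E -> cap s B < b%:E ->
  cap s (A `|` B) < (a + b)%:E.
Proof.
move=> /ereal_inf_lt[_ [u [hu [U [oU AU uU]]] <-] ua].
move=> /ereal_inf_lt[_ [v [hv [W [oW BW vW]]] <-] vb].
have [mu _ _] := hu; have [mv _ _] := hv.
pose w x := Num.max (u x) (v x).
have mw : measurable_fun setT w by exact: measurable_maxr.
have w2 x : (w x ^+ 2 <= u x ^+ 2 + v x ^+ 2)%R.
  by rewrite /w /Num.max; case: ifP => _; rewrite ?lerDl ?lerDr sqr_ge0.
have ws x z : ((w x - w z) ^+ 2 <= (u x - u z) ^+ 2 + (v x - v z) ^+ 2)%R.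
  exact: sqr_maxB_le.
rewrite EFinD; apply: le_lt_trans (lteD ua vb).
rewrite addeACA; apply: le_trans; last first.
  by apply: leeD; [exact: (Hs_seminorm2_leD mw mu mv ws)|
                   exact: (L2_norm2_leD mw mu mv w2)].
apply: ereal_inf_lbound; exists w => //; split.
  exact: Hs_leD hu hv w2 ws.
exists (U `|` W); split; first exact: openU.
  exact: setUSS.
near=> x.
have ux : U x -> (1 <= u x)%R by near: x.
have vx : W x -> (1 <= v x)%R by near: x.
by move=> [/ux|/vx] h; rewrite /w le_max h ?orbT.
Unshelve. all: by end_near. Qed.

Lemma capU_eq0 A B : cap s A = 0 -> cap s B = 0 -> cap s (A `|` B) = 0.
Proof.
move=> A0 B0; apply/eqP; rewrite eq_le cap_ge0 andbT.
apply/lee_addgt0Pr => e e0; rewrite add0e (splitr e); apply/ltW/capU_lt.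
  by rewrite A0 lte_fin divr_gt0.
by rewrite B0 lte_fin divr_gt0.
Qed.

(** Sets of zero capacity are null: a competitor for A is at least 1 on A up to a
null set, so its squared L^2 norm bounds the measure of A. *)
Lemma leb_le_cap A : leb A <= cap s A.
Proof.
apply: le_ereal_inf_tmp => _ [u [[mu _ _] [U [oU AU uU]]] <-].
apply: (@le_trans _ _ (L2_norm2 u)); last by rewrite leeDr// Hs_seminorm2_ge0.
set S := [set x | (1 <= u x)%R].
have mS : measurable S.
  rewrite (_ : S = setT `&` u @^-1` `[1%R, +oo[).
    exact: mu.
  by apply/seteqP; split => x /=; rewrite /S/= in_itv/= andbT; [|case].
have mu2 : measurable_fun setT (fun x => (u x ^+ 2)%:E).
  by apply/measurable_EFinP; exact: measurable_funX.
apply: (@le_trans _ _ (leb S)).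
  by apply: le_leb_ae; apply: filterS uU => x h /AU /h.
rewrite -[leb S]mul1e -integral_cst//.
apply: (@le_trans _ _ (\int[leb]_(x in S) (u x ^+ 2)%:E)).
  apply: ge0_le_integral.
  - exact: mS.
  - by move=> x _; exact: lee01.
  - exact: measurable_cst.
  - exact: measurable_funTS.
  - by move=> x Sx; rewrite lee_fin expr_ge1// (le_trans _ Sx).
apply: ge0_subset_integral => //.
by move=> x _; rewrite lee_fin sqr_ge0.
Qed.

End capacity.

(** * Quasi-open sets and the spaces H^s_0 *)

Section quasi_open_sets.
Context {R : realType} {n : nat}.
Variable s : R.
Hypothesis s_gt0 : (0 < s)%R.
Local Notation E := (Rn R n).
Implicit Types (A B Omega D : set E) (u v w : E -> R).

(** Quasi-openness without the monotonicity of the exceptional open sets, which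
makes stability under finite unions immediate. *)
Definition almost_open A := forall e : R, (0 < e)%R ->
  exists U, [/\ open U, cap s U < e%:E & open (A `|` U)].

(** Finite intersections of the exceptional sets form a decreasing sequence, and
adding them to A still gives open sets, as union distributes over
intersection. *)
Lemma almost_open_quasi_open A : almost_open A -> quasi_open s A.
Proof.
move=> aoA.
have /choice[U UP] k : exists U : set E,
    [/\ open U, cap s U < (k.+1%:R^-1)%:E & open (A `|` U)].
  by apply: aoA; rewrite invr_gt0.
pose O k := \bigcap_(i in `I_k.+1) U i.
have OS k : O k.+1 = O k `&` U k.+1.
  apply/seteqP; split => x /=.
    by move=> Ox; split; [move=> i ik|]; apply: Ox => //=; exact: ltnW.
  by move=> [Ox Ux] i /=; rewrite ltnS leq_eqVlt => /orP[/eqP->|/Ox].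
have O0 : O 0%N = U 0%N.
  apply/seteqP; split => x /= Ux; [exact: Ux|move=> i].
  by rewrite /= ltnS leqn0 => /eqP->.
exists O; split.
- elim=> [|k ih]; first by rewrite O0; have [] := UP 0%N.
  by rewrite OS; apply: openI => //; have [] := UP k.+1.
- by move=> k; rewrite OS; exact: subIsetl.
- elim=> [|k ih]; first by rewrite O0; have [] := UP 0%N.
  by rewrite OS setUIr; apply: openI => //; have [] := UP k.+1.
- apply: (@squeeze_cvge _ _ _ _ (cst 0) _ (fun k => (k.+1%:R^-1)%:E)).
  + apply: nearW => k; rewrite cap_ge0//=; have [_ /ltW + _] := UP k.
    by apply: le_trans; apply: le_cap => // x; apply => /=.
  + exact: cvg_cst.
  + by apply: cvg_EFin; [exact: nearW|exact: cvg_harmonic].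
Qed.

Lemma almost_open_open A : open A -> almost_open A.
Proof.
move=> oA e e0; exists set0; split; first exact: open0.
- by rewrite cap_set0.
- by rewrite setU0.
Qed.

Lemma almost_openU A B : almost_open A -> almost_open B ->
  almost_open (A `|` B).
Proof.
move=> aoA aoB e e0; have e2 : (0 < e / 2)%R by rewrite divr_gt0.
have [U [oU Ue AU]] := aoA _ e2; have [W [oW We BW]] := aoB _ e2.
exists (U `|` W); split; first exact: openU.
- by rewrite (splitr e); exact: capU_lt.
- by rewrite setUACA; exact: openU.
Qed.

Lemma almost_openI_open A D : open D -> almost_open A -> almost_open (D `&` A).
Proof.
move=> oD aoA e e0; have [U [oU Ue AU]] := aoA _ e0.
exists U; split => //; rewrite setUIl; apply: openI => //; exact: openU.
Qed.

Lemma almost_open_bigcup m (A : 'I_m -> set E) :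
  (forall i, almost_open (A i)) -> almost_open [set x | exists i, A i x].
Proof.
move=> aoA; rewrite (_ : [set _ | _] =
    [set x | exists2 i, i \in index_enum 'I_m & A i x]); last first.
  apply/seteqP; split=> x /=; last by move=> [i _]; exists i.
  by move=> [i Ai]; exists i => //; exact: mem_index_enum.
elim: (index_enum _) => [|j r ih].
  rewrite (_ : [set _ | _] = set0); first exact/almost_open_open/open0.
  by rewrite -subset0 => x [].
rewrite (_ : [set _ | _] =
    A j `|` [set x | exists2 i, i \in r & A i x]); first exact: almost_openU.
apply/seteqP; split => x /=.
  by move=> [i]; rewrite inE => /orP[/eqP-> | ir] Ai; [left | right; exists i].
move=> [Aj|[i ir Ai]]; first by exists j => //; rewrite mem_head.
by exists i => //; rewrite inE ir orbT.
Qed.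

Lemma quasi_continuous_neq0 w : quasi_continuous s w ->
  almost_open [set x | w x <> 0%R].
Proof.
move=> qw e e0; have [U [oU Ue cw]] := qw _ e0; exists U; split => //.
have /open_subspaceP[G oG GU] :
    open ((w : subspace (~` U) -> R) @^-1` (~` [set 0%R])).
  move/continuousP : cw; apply; apply: closed_openC.
  exact: closed_eq.
rewrite (_ : _ `|` _ = G `|` U); first exact: openU.
apply/seteqP; split => x /=.
  move=> [wx|]; last by right.
  have [Ux|Ux] := pselect (U x); [by right|left].
  by have [] : (G `&` ~` U) x by rewrite GU; split.
move=> [Gx|]; last by right.
have [Ux|Ux] := pselect (U x); [by right|left].
by have [] : ((w @^-1` (~` [set 0%R])) `&` ~` U) x by rewrite -GU; split.
Qed.

Lemma quasi_continuous_cst (a : R) : quasi_continuous s (fun _ : E => a).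
Proof.
move=> e e0; exists set0; split; first exact: open0.
- by rewrite cap_set0.
- by move=> x; exact: cvg_cst.
Qed.

Lemma quasi_continuousD u v : quasi_continuous s u -> quasi_continuous s v ->
  quasi_continuous s (fun x => u x + v x)%R.
Proof.
move=> qu qv e e0; have e2 : (0 < e / 2)%R by rewrite divr_gt0.
have [U [oU Ue cu]] := qu _ e2; have [W [oW We cv]] := qv _ e2.
exists (U `|` W); split; first exact: openU.
  by rewrite (splitr e); exact: capU_lt.
have cu' : {within ~` (U `|` W), continuous u}.
  by apply: continuous_subspaceW cu; exact: subsetC.
have cv' : {within ~` (U `|` W), continuous v}.
  by apply: continuous_subspaceW cv; exact: subsetC.
by move=> x; apply: cvgD; [exact: cu'|exact: cv'].
Qed.

Lemma quasi_continuousZ (a : R) u : quasi_continuous s u ->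
  quasi_continuous s (fun x => a * u x)%R.
Proof.
move=> qu e /qu[U [oU Ue cu]]; exists U; split => // x.
by apply: cvgM; [exact: cvg_cst|exact: cu].
Qed.

Lemma H0s_cst0 Omega : H0s s Omega (fun=> 0%R).
Proof.
split; first exact: Hs0.
exists (fun=> 0%R); split; first exact: quasi_continuous_cst.
- exact: nearW.
- by rewrite (_ : [set _ | _] = set0) ?cap_set0// -subset0 => x [].
Qed.

Lemma H0sD Omega u v : H0s s Omega u -> H0s s Omega v ->
  H0s s Omega (fun x => u x + v x)%R.
Proof.
move=> [hu [wu [qu uE u0]]] [hv [wv [qv vE v0]]]; split; first exact: HsD.
exists (fun x => wu x + wv x)%R; split; first exact: quasi_continuousD.
- by apply: filterS2 uE vE => x -> ->.
- apply/eqP; rewrite eq_le cap_ge0// andbT -(capU_eq0 s_gt0 u0 v0).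
  apply: le_cap => // x [Ox wx].
  have [ux|ux] := eqVneq (wu x) 0%R; last by left; split => //; exact/eqP.
  by right; split => // vx; apply: wx; rewrite ux vx addr0.
Qed.

Lemma H0sZ Omega (a : R) u : H0s s Omega u -> H0s s Omega (fun x => a * u x)%R.
Proof.
move=> [hu [wu [qu uE u0]]]; split; first exact: HsZ.
exists (fun x => a * wu x)%R; split; first exact: quasi_continuousZ.
- by apply: filterS uE => x ->.
- apply/eqP; rewrite eq_le cap_ge0// andbT -u0.
  apply: le_cap => // x [Ox wx]; split => // ux.
  by apply: wx; rewrite ux mulr0.
Qed.

Lemma H0s_lincomb Omega k (e : 'I_k -> E -> R) c :
  (forall i, H0s s Omega (e i)) -> H0s s Omega (lincomb e c).
Proof.
move=> he; rewrite /lincomb; elim: (index_enum _) => [|j r ih].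
  by under eq_fun do rewrite big_nil; exact: H0s_cst0.
under eq_fun do rewrite big_cons.
by apply: H0sD ih; exact: H0sZ (he j).
Qed.

Lemma H0s_ae_support Omega u : H0s s Omega u ->
  {ae leb, forall x, u x <> 0%R -> Omega x}.
Proof.
move=> [hu [w [qw wE w0]]].
have /leb0_negligible : leb [set x | ~ Omega x /\ w x <> 0%R] = 0.
  by apply/eqP; rewrite eq_le lebesgue_outer_ge0 andbT -w0 leb_le_cap.
rewrite -[X in _.-negligible X]setCK => nw.
have : {ae leb, forall x, ~ (~ Omega x /\ w x <> 0%R)} by exact: nw.
apply: filterS2 wE => x <- h wx; apply: contrapT => Ox; exact: h.
Qed.

(** The set produced is the part in D of the set where the quasi-continuous
representatives of the components of W do not all vanish. *)
Lemma H0s_quasi_open_support D m (W : 'I_m -> E -> R) : open D ->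
  (forall i, H0s s D (W i)) ->
  exists Omega, [/\ Omega `<=` D, quasi_open s Omega,
    forall i, H0s s Omega (W i) &
    leb Omega <= leb [set x | (0 < vnorm W x)%R]].
Proof.
move=> oD hW; have hWs i : Hs s (W i) by have [] := hW i.
have /choice[w wP] i : exists w : E -> R, [/\ quasi_continuous s w,
    {ae leb, forall x, w x = W i x} &
    cap s [set x | ~ D x /\ w x <> 0%R] = 0].
  by have [_] := hW i.
exists (D `&` [set x | exists i, w i x <> 0%R]); split.
- exact: subIsetl.
- apply: almost_open_quasi_open; apply: almost_openI_open => //.
  apply: almost_open_bigcup => i; apply: quasi_continuous_neq0.
  by have [] := wP i.
- move=> i; split => //; have [qw wE w0] := wP i; exists (w i); split => //.
  apply/eqP; rewrite eq_le cap_ge0// andbT -w0; apply: le_cap => // x [DWx wx].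
  by split => // Dx; apply: DWx; split => //; exists i.
- apply: le_leb_ae.
  have : {ae leb, forall x (i : 'I_m), w i x = W i x}.
    by apply: filter_forall => i; have [] := wP i.
  apply: filterS => x wW [_ [i]]; rewrite wW => /eqP Wx.
  rewrite /= /vnorm sqrtr_gt0 (bigD1 i)//= ltr_pwDl ?sumr_ge0// => [|j _].
    by rewrite exprn_even_gt0.
  by rewrite sqr_ge0.
Qed.

End quasi_open_sets.

(** * Sums of eigenvalues *)

Section reflections.
Context {R : realType}.
Local Open Scope ring_scope.

(** The image of a under the orthogonal reflection of R^k in the hyperplane
orthogonal to v; it is the identity for v = 0, because 0 is then the inverse of
the squared norm of v. *)
Definition reflection k (v a : 'I_k -> R) (j : 'I_k) : R :=
  a j - 2 * (\sum_i v i * a i) / (\sum_i v i ^+ 2) * v j.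

Lemma sum_sqr_eq0 k (c : 'I_k -> R) : \sum_i c i ^+ 2 = 0 -> forall i, c i = 0.
Proof.
move=> /eqP; rewrite psumr_eq0 => [/allP c0 i|i _]; last exact: sqr_ge0.
by apply/eqP; rewrite -sqrf_eq0 (implyP (c0 i (mem_index_enum i))).
Qed.

Lemma sum_sqrB k (t : R) (a v : 'I_k -> R) :
  \sum_j (a j - t * v j) ^+ 2 =
  \sum_j a j ^+ 2 - 2 * t * (\sum_j v j * a j) + t ^+ 2 * \sum_j v j ^+ 2.
Proof.
rewrite !mulr_sumr -sumrB -big_split/=.
by apply: eq_bigr => j _; ring.
Qed.

Lemma sqr_dot_le k (c a : 'I_k -> R) :
  (\sum_i c i * a i) ^+ 2 <= (\sum_i c i ^+ 2) * \sum_i a i ^+ 2.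
Proof.
set q := \sum_i c i ^+ 2; set p := \sum_i c i * a i.
have : 0 <= q by apply: sumr_ge0 => i _; exact: sqr_ge0.
rewrite le_eqVlt => /orP[/eqP q0|q0].
  rewrite -q0 mul0r (_ : p = 0) ?expr0n//.
  by apply: big1 => i _; rewrite sum_sqr_eq0 ?mul0r.
(* The squared distance from a to its projection on the line of c. *)
have := @sumr_ge0 _ _ (index_enum 'I_k) xpredT (fun j => (a j - p / q * c j) ^+ 2).
rewrite sum_sqrB -/q -/p => /(_ (fun i _ => sqr_ge0 _)) h.
rewrite -subr_ge0 (_ : _ - _ = q * (\sum_j a j ^+ 2 - 2 * (p / q) * p + (p / q) ^+ 2 * q)).
  by rewrite mulr_ge0// ltW.
by field; rewrite gt_eqF.
Qed.

Lemma sum_sqr_reflection k (v a : 'I_k -> R) :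
  \sum_j reflection v a j ^+ 2 = \sum_j a j ^+ 2.
Proof.
rewrite sum_sqrB; set q := \sum_i v i ^+ 2; set p := \sum_i v i * a i.
have [->|q0] := eqVneq q 0; first by rewrite invr0 !mulr0 mul0r subr0 addr0.
by field.
Qed.

(** Reflections are self-adjoint. *)
Lemma reflection_dot k (v a d : 'I_k -> R) :
  \sum_j d j * reflection v a j = \sum_j reflection v d j * a j.
Proof.
have sumE (x y : 'I_k -> R) (t : R) :
    \sum_j (x j - t * v j) * y j = \sum_j x j * y j - t * \sum_j v j * y j.
  by rewrite mulr_sumr -sumrB; apply: eq_bigr => j _; ring.
under eq_bigr do rewrite mulrC; rewrite !sumE.
rewrite (eq_bigr (fun j => d j * a j)) => [|j _]; last exact: mulrC.
ring.
Qed.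

Lemma reflectionB k (v a b : 'I_k -> R) j :
  reflection v a j - reflection v b j = reflection v (fun i => a i - b i) j.
Proof.
rewrite /reflection; under [in RHS]eq_bigr do rewrite mulrBr.
rewrite sumrB; ring.
Qed.

(** The reflection along c - e_j, for a unit vector c, sends e_j to c, hence its
j-th coordinate is the scalar product with c. *)
Lemma reflection_basis k (c a : 'I_k -> R) j : \sum_i c i ^+ 2 = 1 ->
  reflection (fun i => c i - (i == j)%:R) a j = \sum_i c i * a i.
Proof.
move=> c1; rewrite /reflection eqxx.
have dot (b : 'I_k -> R) : \sum_i (c i - (i == j)%:R) * b i =
    \sum_i c i * b i - b j.
  under eq_bigr do rewrite mulrBl.
  rewrite sumrB; congr (_ - _); rewrite (bigD1 j)//= eqxx mul1r big1 ?addr0//.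
  by move=> i /negbTE ->; rewrite mul0r.
rewrite dot; under [X in _ / X]eq_bigr do rewrite expr2.
rewrite dot; under [X in _ / (X - _)]eq_bigr do rewrite mulrC.
rewrite dot eqxx; under [X in _ / (X - _ - _)]eq_bigr do rewrite -expr2.
rewrite c1 /= mulr1n.
have [cj1|cj1] := eqVneq (c j) 1; last first.
  by field; rewrite (_ : _ + _ = 2 * (1 - c j)); [rewrite mulf_neq0// subr_eq0 eq_sym|ring].
(* Here c is the j-th basis vector. *)
rewrite cj1 !subrr mulr0 subr0 (bigD1 j)//= cj1 mul1r big1 ?addr0// => i ij.
move: c1; rewrite (bigD1 j)//= cj1 expr1n => /eqP.
rewrite eq_sym addrC -subr_eq subrr eq_sym psumr_eq0 => [/allP|l _]; last exact: sqr_ge0.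
by move=> /(_ i (mem_index_enum i)); rewrite ij/= sqrf_eq0 => /eqP->; rewrite mul0r.
Qed.

End reflections.

Section eigenvalue_sums.
Context {R : realType} {n : nat}.
Variable s : R.
Hypothesis s_gt0 : (0 < s)%R.
Local Notation E := (Rn R n).
Variable Omega : set E.

Lemma H0s_Hs u : H0s s Omega u -> Hs s u.
Proof. by case. Qed.

Lemma lincombZ k (e : 'I_k -> E -> R) (a : R) c :
  lincomb e (fun i => a * c i)%R = (fun x => a * lincomb e c x)%R.
Proof.
apply/funext => x; rewrite /lincomb mulr_sumr.
by apply: eq_bigr => i _; rewrite mulrA.
Qed.

Lemma Hs_seminorm2_lincomb_le k (e : 'I_k -> E -> R) c :
  (forall i, measurable_fun setT (e i)) -> (\sum_i c i ^+ 2 = 1)%R ->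
  Hs_seminorm2 s (lincomb e c) <= \sum_i Hs_seminorm2 s (e i).
Proof.
move=> me c1.
have := @le_sum_Hs_seminorm2 R n s s_gt0 'I_1 'I_k (fun=> lincomb e c) e.
rewrite big_ord1; apply => //; first by move=> _; exact: measurable_lincomb.
move=> x z; rewrite big_ord1 /lincomb -sumrB.
under eq_bigr do rewrite -mulrBr.
by apply: le_trans (sqr_dot_le _ _) _; rewrite c1 mul1r.
Qed.

Lemma L2_norm2_ae0 (u : E -> R) : measurable_fun setT u -> ae0 u ->
  L2_norm2 u = 0.
Proof.
move=> mu u0; apply/eqP; rewrite eq_le L2_norm2_ge0 andbT.
rewrite -(@integral0 _ _ _ (@leb R n) setT); apply: ae_ge0_le_integral.
- exact: measurableT.
- by move=> x _; rewrite lee_fin sqr_ge0.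
- by apply/measurable_EFinP; exact: measurable_funX.
- by [].
- exact: measurable_cst.
- by apply: filterS u0 => x -> _; rewrite expr0n.
Qed.

Lemma subspace_of_dim_range k (e : 'I_k -> E -> R) (kappa : R) :
  (0 < kappa)%R -> (forall i, measurable_fun setT (e i)) ->
  (forall c, (kappa * \sum_i c i ^+ 2)%:E <= L2_norm2 (lincomb e c)) ->
  subspace_of_dim k (range (lincomb e)).
Proof.
move=> k0 me ek; exists e; split => // c c0.
have := ek c; rewrite L2_norm2_ae0//; last exact: measurable_lincomb.
rewrite lee_fin pmulr_rle0// => c2.
apply: sum_sqr_eq0; apply/eqP; rewrite eq_le c2/=.
by apply: sumr_ge0 => i _; exact: sqr_ge0.
Qed.

(** If e satisfies ||c.e||^2 >= kappa |c|^2, the Rayleigh quotients on its span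
are controlled by the energies over unit vectors of coefficients. *)
Lemma rayleigh_lincomb_le k (e : 'I_k -> E -> R) (kappa M : R) d :
  (0 < kappa)%R -> (forall i, H0s s Omega (e i)) ->
  (forall c, (kappa * \sum_i c i ^+ 2)%:E <= L2_norm2 (lincomb e c)) ->
  (forall c, (\sum_i c i ^+ 2 = 1)%R ->
    Hs_seminorm2 s (lincomb e c) <= M%:E) ->
  ~ ae0 (lincomb e d) -> (rayleigh s (lincomb e d) <= kappa^-1 * M)%R.
Proof.
move=> k0 he ek eM ned.
have hH c : Hs s (lincomb e c) by apply: H0s_Hs; exact: H0s_lincomb.
set N := (\sum_i d i ^+ 2)%R.
have N_ge0 : (0 <= N)%R by apply: sumr_ge0 => i _; exact: sqr_ge0.
have N_gt0 : (0 < N)%R.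
  rewrite lt_neqAle N_ge0 andbT eq_sym; apply/eqP => N0; apply: ned.
  apply: nearW => x; rewrite /lincomb big1// => i _.
  by rewrite (sum_sqr_eq0 N0) mul0r.
pose r := Num.sqrt N; have rN : (r ^+ 2 = N)%R by rewrite sqr_sqrtr.
have r0 : (r != 0)%R by rewrite gt_eqF// sqrtr_gt0.
pose c i := (r^-1 * d i)%R.
have c1 : (\sum_i c i ^+ 2 = 1)%R.
  rewrite /c; under eq_bigr do rewrite exprMn.
  by rewrite -mulr_sumr -/N exprVn rN mulVf ?gt_eqF.
have dE : lincomb e d = (fun x => r * lincomb e c x)%R.
  by rewrite /c lincombZ; apply/funext => x; rewrite mulrA divff ?mul1r.
have [mc _ _] := hH c.
have M0 : (0 <= M)%R.
  by rewrite -lee_fin; apply: le_trans (eM _ c1); exact: Hs_seminorm2_ge0.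
have [_ d2 ds] := hH d.
have L2_fin : L2_norm2 (lincomb e d) \is a fin_num.
  by rewrite ge0_fin_numE// L2_norm2_ge0.
have kN : (kappa * N <= fine (L2_norm2 (lincomb e d)))%R.
  by rewrite -lee_fin fineK//; exact: ek.
rewrite /rayleigh ler_pdivrMr; last by apply: lt_le_trans kN; rewrite mulr_gt0.
apply: (@le_trans _ _ (N * M)%R).
  rewrite -lee_fin fineK; last by rewrite ge0_fin_numE// Hs_seminorm2_ge0.
  rewrite dE Hs_seminorm2Z// rN EFinM; apply: lee_wpmul2l; first by rewrite lee_fin.
  exact: eM.
apply: (@le_trans _ _ (kappa^-1 * M * (kappa * N))%R).
  by rewrite le_eqVlt; apply/orP; left; apply/eqP; field; rewrite gt_eqF.
by apply: ler_wpM2l kN; rewrite mulr_ge0// invr_ge0 ltW.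
Qed.

Lemma lambda_le k (e : 'I_k -> E -> R) (kappa M : R) :
  (0 < kappa)%R -> (forall i, H0s s Omega (e i)) ->
  (forall c, (kappa * \sum_i c i ^+ 2)%:E <= L2_norm2 (lincomb e c)) ->
  (forall c, (\sum_i c i ^+ 2 = 1)%R ->
    Hs_seminorm2 s (lincomb e c) <= M%:E) ->
  lambda s k Omega <= (kappa^-1 * M)%:E.
Proof.
move=> k0 he ek eM.
apply: (@le_trans _ _
  (ereal_sup [set (rayleigh s u)%:E | u in range (lincomb e) `\` @ae0 R n])).
  apply: ereal_inf_lbound; exists (range (lincomb e)) => //; split.
    apply: subspace_of_dim_range k0 _ ek => i.
    by have /H0s_Hs[] := he i.
  by move=> _ [c _ <-]; exact: H0s_lincomb.
apply: ge_ereal_sup => _ [u [[d _ <-] nd] <-].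
by rewrite lee_fin; exact: rayleigh_lincomb_le.
Qed.

(** The family obtained from e by reflecting, at each point x, the vector of the
values e_i(x). *)
Definition reflect_family k (v : 'I_k -> R) (e : 'I_k -> E -> R) j : E -> R :=
  fun x => reflection v (e ^~ x) j.

Lemma lincomb_reflect_family k (v : 'I_k -> R) (e : 'I_k -> E -> R) d :
  lincomb (reflect_family v e) d = lincomb e (reflection v d).
Proof. by apply/funext => x; exact: reflection_dot. Qed.

Lemma reflect_familyE k (v : 'I_k -> R) (e : 'I_k -> E -> R) j :
  reflect_family v e j = lincomb e (reflection v (fun i => (i == j)%:R)).
Proof.
rewrite -lincomb_reflect_family; apply/funext => x.
rewrite /lincomb (bigD1 j)//= eqxx mul1r big1 ?addr0// => i /negbTE ->.
by rewrite mul0r.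
Qed.

Lemma sum_Hs_seminorm2_reflect k (v : 'I_k -> R) (e : 'I_k -> E -> R) :
  (forall i, H0s s Omega (e i)) ->
  \sum_i Hs_seminorm2 s (reflect_family v e i) <= \sum_i Hs_seminorm2 s (e i).
Proof.
move=> he; apply: le_sum_Hs_seminorm2; first exact: s_gt0.
- move=> i; rewrite reflect_familyE; apply: measurable_lincomb => j.
  by have /H0s_Hs[] := he j.
- by move=> j; have /H0s_Hs[] := he j.
- move=> x z; rewrite /reflect_family; under eq_bigr do rewrite reflectionB.
  by rewrite sum_sqr_reflection.
Qed.

(** The error eta is spent at each of the k choices of a near-maximizer. *)
Lemma sum_lambda_le_eta (kappa eta : R) : (0 < kappa)%R -> (0 < eta)%R ->
  forall k (e : 'I_k -> E -> R),
  (forall i, H0s s Omega (e i)) ->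
  (forall c, (kappa * \sum_i c i ^+ 2)%:E <= L2_norm2 (lincomb e c)) ->
  \sum_(i < k) lambda s i.+1 Omega <=
    (kappa^-1)%:E * (\sum_i Hs_seminorm2 s (e i) + (k%:R * eta)%:E).
Proof.
move=> kappa0 eta0; have kappaV0 : 0 <= (kappa^-1)%:E.
  by rewrite lee_fin invr_ge0 ltW.
elim=> [|k ih] e he ek.
  by rewrite !big_ord0 mul0r adde0 mule0.
have me i : measurable_fun setT (e i) by have /H0s_Hs[] := he i.
pose Q c := Hs_seminorm2 s (lincomb e c).
pose B := [set Q c | c in [set c | (\sum_i c i ^+ 2 = 1)%R]].
have Bub c : (\sum_i c i ^+ 2 = 1)%R -> Q c <= ereal_sup B.
  by move=> c1; apply: ereal_sup_ubound; exists c.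
pose c0 (i : 'I_k.+1) : R := (i == ord_max)%:R.
have c01 : (\sum_i c0 i ^+ 2 = 1)%R.
  rewrite (bigD1 ord_max)//= /c0 eqxx expr1n big1 ?addr0// => i /negbTE ->.
  by rewrite expr0n.
have sup_fin : ereal_sup B \is a fin_num.
  rewrite ge0_fin_numE; last first.
    by apply: le_trans (Bub _ c01); exact: Hs_seminorm2_ge0.
  apply: (@le_lt_trans _ _ (\sum_i Hs_seminorm2 s (e i))).
    by apply: ge_ereal_sup => _ [c /= c1 <-]; exact: Hs_seminorm2_lincomb_le.
  by apply: lte_sum_pinfty => i _; have /H0s_Hs[] := he i.
have [_ [c /= c1 <-] cB] := ub_ereal_sup_adherent eta0 sup_fin.
(* The new family has the same total energy, and its last member nearly
   maximizes the energy over the unit sphere of the span. *)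
pose v i := (c i - (i == ord_max)%:R)%R; pose f := reflect_family v e.
have f_last : f ord_max = lincomb e c.
  by apply/funext => x; exact: reflection_basis.
have hf i : H0s s Omega (f i) by rewrite /f reflect_familyE; exact: H0s_lincomb.
pose g i := f (widen_ord (leqnSn k) i).
have gk d : (kappa * \sum_i d i ^+ 2)%:E <= L2_norm2 (lincomb g d).
  (* Extend d by 0 in the last coordinate. *)
  pose d' (i : 'I_k.+1) : R := oapp d 0%R (insub (val i)).
  have d'w i : d' (widen_ord (leqnSn k) i) = d i by rewrite /d'/= valK.
  have d'l : d' ord_max = 0%R by rewrite /d' insubF// ltnn.
  have -> : lincomb g d = lincomb e (reflection v d').
    rewrite -lincomb_reflect_family; apply/funext => x.
    rewrite [RHS]/lincomb big_ord_recr/= d'l mul0r addr0.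
    by apply: eq_bigr => i _; rewrite d'w.
  have -> : (\sum_i d i ^+ 2 = \sum_i d' i ^+ 2)%R.
    rewrite big_ord_recr/= d'l expr0n/= addr0.
    by apply: eq_bigr => i _; rewrite d'w.
  by rewrite -(sum_sqr_reflection v); exact: ek.
have := ih g (fun i => hf _) gk => ihg.
have top : lambda s k.+1 Omega <= (kappa^-1)%:E * (Q c + eta%:E).
  apply: le_trans (lambda_le kappa0 he ek (M := fine (ereal_sup B)) _) _.
    by move=> d d1; rewrite fineK//; exact: Bub.
  rewrite EFinM fineK//; apply: lee_wpmul2l => //.
  by rewrite -leeBlDr// ltW.
rewrite big_ord_recr/=; apply: le_trans (leeD ihg top) _.
have s0 (u : E -> R) : 0 <= Hs_seminorm2 s u by exact: Hs_seminorm2_ge0.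
rewrite -ge0_muleDr; last 2 first.
- apply: adde_ge0; first by apply: sume_ge0.
  by rewrite lee_fin mulr_ge0// ltW.
- by apply: adde_ge0; [exact: s0|rewrite lee_fin ltW].
apply: lee_wpmul2l => //; rewrite addeACA -EFinD.
rewrite -{2}(mul1r eta) -mulrDl -natr1; apply: leeD => //.
apply: le_trans (sum_Hs_seminorm2_reflect v he).
by rewrite big_ord_recr/= -/f f_last.
Qed.

Lemma sum_lambda_le k (e : 'I_k -> E -> R) (kappa : R) : (0 < kappa)%R ->
  (forall i, H0s s Omega (e i)) ->
  (forall c, (kappa * \sum_i c i ^+ 2)%:E <= L2_norm2 (lincomb e c)) ->
  \sum_(i < k) lambda s i.+1 Omega <=
    (kappa^-1)%:E * \sum_i Hs_seminorm2 s (e i).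
Proof.
move=> kappa0 he ek; apply/lee_addgt0Pr => eps eps0.
have k0 : (0 < k.+1%:R :> R)%R by rewrite ltr0n.
pose eta := (kappa * eps / k.+1%:R)%R.
have eta0 : (0 < eta)%R by rewrite divr_gt0// mulr_gt0.
apply: le_trans (sum_lambda_le_eta kappa0 eta0 he ek) _.
rewrite ge0_muleDr; last 2 first.
- by apply: sume_ge0 => i _; exact: Hs_seminorm2_ge0.
- by rewrite lee_fin mulr_ge0// ltW.
apply: leeD => //; rewrite -EFinM lee_fin /eta.
rewrite (_ : kappa^-1 * _ = eps * (k%:R / k.+1%:R))%R; last first.
  by field; rewrite !gt_eqF.
apply: ler_piMr; first exact: ltW.
by rewrite ler_pdivrMr// mul1r ler_nat.
Qed.

End eigenvalue_sums.

(** * Near-orthonormality in L^2 *)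

Section orthonormal_families.
Context {R : realType} {n : nat}.
Variable s : R.
Hypothesis s_gt0 : (0 < s)%R.
Local Notation E := (Rn R n).

Lemma integrable_mul_Hs (u v : E -> R) : Hs s u -> Hs s v ->
  (@leb R n).-integrable setT (fun x => (u x * v x)%:E).
Proof.
move=> [mu u2 _] [mv v2 _].
have msqr (w : E -> R) : measurable_fun setT w ->
    measurable_fun setT (fun x => (w x ^+ 2)%:E).
  by move=> mw; apply/measurable_EFinP; exact: measurable_funX.
apply/integrableP; split.
  by apply/measurable_EFinP; exact: measurable_funM.
apply: (@le_lt_trans _ _ (L2_norm2 u + L2_norm2 v)); last exact: lte_add_pinfty.
rewrite /L2_norm2 -ge0_integralD; last 5 first.
- exact: measurableT.
- by move=> x _; rewrite lee_fin sqr_ge0.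
- exact: msqr.
- by move=> x _; rewrite lee_fin sqr_ge0.
- exact: msqr.
apply: ge0_le_integral.
- exact: measurableT.
- by move=> x _; exact: abse_ge0.
- apply: measurableT_comp; first exact: abse_measurable.
  by apply/measurable_EFinP; exact: measurable_funM.
- by apply: emeasurable_funD; exact: msqr.
- move=> x _; rewrite -EFinD abse_EFin lee_fin ler_norml; apply/andP; split.
    by have := sqr_ge0 (u x + v x)%R; nra.
  by have := sqr_ge0 (u x - v x)%R; nra.
Qed.

Lemma L2_norm2_orthonormal m (V : 'I_m -> E -> R) c :
  (forall i, Hs s (V i)) ->
  (forall i j, L2_prod (V i) (V j) = (i == j)%:R%:E) ->
  L2_norm2 (lincomb V c) = (\sum_i c i ^+ 2)%R%:E.
Proof.
move=> hV oV; rewrite /L2_norm2.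
have -> : (fun x => (lincomb V c x ^+ 2)%:E) =
    (fun x => \sum_i \sum_j (c i * c j)%:E * (V i x * V j x)%:E).
  apply/funext => x; rewrite /lincomb expr2 mulr_suml -sumEFin.
  apply: eq_bigr => i _; rewrite mulr_sumr -sumEFin.
  by apply: eq_bigr => j _; rewrite -EFinM mulrACA.
have iV i j : (@leb R n).-integrable setT
    (fun x => (c i * c j)%:E * (V i x * V j x)%:E).
  by apply: integrableZl => //; exact: integrable_mul_Hs.
rewrite integral_sum//; last first.
  by move=> i; apply: integrable_sum => // j _; exact: iV.
rewrite -sumEFin; apply: eq_bigr => i _; rewrite integral_sum//.
rewrite (bigD1 i)//= big1 ?adde0 => [|j ji]; rewrite integralZl//;
  try exact: integrable_mul_Hs.
  by rewrite -/(L2_prod _ _) oV eqxx mule1 expr2.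
by rewrite -/(L2_prod _ _) oV eq_sym (negbTE ji) mule0.
Qed.

End orthonormal_families.

Section bounded_families.
Context {R : realType} {n m : nat}.
Local Notation E := (Rn R n).
Implicit Types V W : 'I_m -> E -> R.

Lemma vnorm_ge0 V x : (0 <= vnorm V x)%R.
Proof. exact: sqrtr_ge0. Qed.

Lemma vnorm_eq0 V x : (forall i, V i x = 0%R) -> vnorm V x = 0%R.
Proof.
by move=> V0; rewrite /vnorm big1 ?sqrtr0// => i _; rewrite V0 expr0n.
Qed.

Lemma normr_lincomb_le V c x :
  (`|lincomb V c x| <= Num.sqrt (\sum_i c i ^+ 2) * vnorm V x)%R.
Proof.
rewrite -sqrtr_sqr -sqrtrM; last by apply: sumr_ge0 => i _; exact: sqr_ge0.
by rewrite ler_wsqrtr// sqr_dot_le.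
Qed.

Lemma vnormBC V W :
  vnorm (fun i x => V i x - W i x)%R = vnorm (fun i x => W i x - V i x)%R.
Proof.
apply/funext => x; congr Num.sqrt.
by apply: eq_bigr => i _; rewrite -sqrrN opprB.
Qed.

Lemma sqr_lincomb_le V W (delta : R) c x :
  (vnorm V x <= delta)%R -> (vnorm W x <= delta)%R ->
  (lincomb V c x ^+ 2 <= lincomb W c x ^+ 2 +
    2 * delta * (\sum_i c i ^+ 2) * vnorm (fun i x => W i x - V i x) x)%R.
Proof.
move=> Vd Wd; rewrite vnormBC; set N := (\sum_i c i ^+ 2)%R.
have N0 : (0 <= N)%R by apply: sumr_ge0 => i _; exact: sqr_ge0.
rewrite -lerBlDl subr_sqr; apply: le_trans (ler_norm _) _; rewrite normrM.
have sN : (N = Num.sqrt N * Num.sqrt N)%R by rewrite -expr2 sqr_sqrtr.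
rewrite (_ : 2 * _ * _ * _ = (Num.sqrt N * vnorm (fun i x => V i x - W i x) x) *
   (2 * (Num.sqrt N * delta)))%R; last by rewrite {1}sN; ring.
apply: ler_pM => //.
  rewrite (_ : _ - _ = lincomb (fun i x => V i x - W i x) c x)%R.
    exact: normr_lincomb_le.
  by rewrite /lincomb -sumrB; apply: eq_bigr => i _; rewrite mulrBr.
apply: le_trans (ler_normD _ _) _; rewrite mulr_natl mulr2n.
by apply: lerD; apply: le_trans (normr_lincomb_le _ _ _) _;
  rewrite ler_wpM2l ?sqrtr_ge0.
Qed.

Lemma L2_norm2_lincomb_le V W (delta : R) c :
  (forall i, measurable_fun setT (V i)) ->
  (forall i, measurable_fun setT (W i)) ->
  {ae leb, forall x, vnorm V x <= delta}%R ->
  {ae leb, forall x, vnorm W x <= delta}%R -> (0 <= delta)%R ->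
  L2_norm2 (lincomb V c) <= L2_norm2 (lincomb W c) +
    (2 * delta * (\sum_i c i ^+ 2))%:E *
    'N[leb]_1[EFin \o vnorm (fun i x => (W i x - V i x)%R)].
Proof.
move=> mV mW Vd Wd d0.
have N0 : (0 <= \sum_i c i ^+ 2)%R by apply: sumr_ge0 => i _; exact: sqr_ge0.
have mWV : measurable_fun setT (vnorm (fun i x => (W i x - V i x)%R)).
  by apply: measurable_vnorm => i; exact: measurable_funB.
have mE : measurable_fun setT (EFin \o vnorm (fun i x => (W i x - V i x)%R)).
  exact/measurable_EFinP.
have k0 : (0 <= 2 * delta * \sum_i c i ^+ 2)%R by rewrite !mulr_ge0.
rewrite Lnorm1.
under eq_integral do rewrite /= ger0_norm ?vnorm_ge0//.
rewrite -ge0_integralZl; last 4 first.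
- exact: measurableT.
- exact: mE.
- by move=> x _; rewrite lee_fin vnorm_ge0.
- by rewrite lee_fin.
have msqr (w : E -> R) : measurable_fun setT w ->
    measurable_fun setT (fun x => (w x ^+ 2)%:E).
  by move=> mw; apply/measurable_EFinP; exact: measurable_funX.
rewrite /L2_norm2 -ge0_integralD; last 5 first.
- exact: measurableT.
- by move=> x _; rewrite lee_fin sqr_ge0.
- by apply: msqr; exact: measurable_lincomb.
- by move=> x _; rewrite mule_ge0// lee_fin vnorm_ge0.
- exact: measurable_funeM.
apply: ae_ge0_le_integral.
- exact: measurableT.
- by move=> x _; rewrite lee_fin sqr_ge0.
- by apply: msqr; exact: measurable_lincomb.
- move=> x _; apply: adde_ge0; first by rewrite lee_fin sqr_ge0.
  by apply: mule_ge0; rewrite lee_fin ?vnorm_ge0.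
- apply: emeasurable_funD; last exact: measurable_funeM.
  by apply: msqr; exact: measurable_lincomb.
- apply: filterS2 Vd Wd => x Vd Wd _.
  by rewrite -EFinM -EFinD lee_fin; exact: sqr_lincomb_le.
Qed.

Lemma Lnorm_oo_ae (f : E -> \bar R) (c : R) :
  'N[leb]_+oo[f] <= c%:E -> {ae leb, forall x, `|f x| <= c%:E}.
Proof.
rewrite unlock; case: ifPn => [_ /ess_supP//|].
rewrite -leNgt => T0 _; exists setT; split => //.
by apply/eqP; rewrite eq_le T0 lebesgue_outer_ge0.
Qed.

End bounded_families.

Section eigenfunctions.
Context {R : realType} {n : nat}.
Variable s : R.
Local Notation E := (Rn R n).

Lemma Hs_vseminorm2_eigenfunctions m (Omega : set E) (V : 'I_m -> E -> R) :
  normalized_eigenfunctions s Omega V ->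
  Hs_vseminorm2 s V = \sum_(i < m) lambda s i.+1 Omega.
Proof.
move=> [hV oV eV]; apply: eq_bigr => i _.
by rewrite -[LHS]/(Hs_form s (V i) (V i)) eV// oV eqxx mule1.
Qed.

Hypothesis s_gt0 : (0 < s)%R.

Lemma H0s_vnorm_ae_support m (Omega : set E) (V : 'I_m -> E -> R) :
  (forall i, H0s s Omega (V i)) ->
  {ae leb, forall x, (0 < vnorm V x)%R -> Omega x}.
Proof.
move=> hV.
have : {ae leb, forall x (i : 'I_m), V i x <> 0%R -> Omega x}.
  by apply: filter_forall => i; exact: H0s_ae_support (hV i).
apply: filterS => x VO Vx; apply: contrapT => Ox.
move: Vx; rewrite vnorm_eq0 ?ltxx// => i.
by apply: contrapT => /VO.
Qed.

End eigenfunctions.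

Lemma inv_1B_le (R : realFieldType) (x : R) : (0 <= x)%R -> (2 * x <= 1)%R ->
  ((1 - x)^-1 <= 1 + 2 * x)%R.
Proof.
move=> x0 x1; rewrite -div1r ler_pdivrMr; last by lra.
nra.
Qed.

(** * Almost-minimality *)

Unset Implicit Arguments.

Theorem proposition2p1 (R : realType) (n m : nat) (hn : (1 <= n)%N)
    (hm : (1 <= m)%N) (s : R) (hs : (0 < s < 1)%R) (D : set (Rn R n))
    (Dopen : open D) (Dbounded : bounded_set D) (L : R) (hL : (0 < L)%R)
    (Omega : set (Rn R n)) (HOmega : shape_optimizer s m L D Omega)
    (V : 'I_m -> Rn R n -> R) (HV : normalized_eigenfunctions s Omega V) :
  forall delta : R, 'N[leb]_+oo[(EFin \o vnorm V) \_ Omega] <= delta%:E ->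
  exists K eps : R, [/\ (0 < K)%R, (0 < eps)%R &
    forall W : 'I_m -> Rn R n -> R, (forall i, H0s s D (W i)) ->
      'N[leb]_+oo[EFin \o vnorm W] <= delta%:E ->
      'N[leb]_1[EFin \o vnorm (fun i x => (V i x - W i x)%R)] <= eps%:E ->
      Hs_vseminorm2 s V + L%:E * leb [set x | (0 < vnorm V x)%R] <=
      (1 + K%:E * 'N[leb]_1[EFin \o vnorm (fun i x => (W i x - V i x)%R)]) *
        Hs_vseminorm2 s W + L%:E * leb [set x | (0 < vnorm W x)%R]].
Proof.
have s0 : (0 < s)%R by case/andP: hs.
have [Om_sub Om_qo Om_opt] := HOmega; have [hV oV eV] := HV.
(* M is a positive bound for |V| and |W|; delta itself is not known to be
   positive. *)
move=> delta Vdelta; pose M := (`|delta| + 1)%R.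
have M0 : (0 < M)%R by rewrite ltr_wpDl.
have deltaM : (delta <= M)%R.
  by apply: le_trans (ler_norm _) _; rewrite lerDl.
have mV i : measurable_fun setT (V i) by have [[]] := hV i.
have VM : {ae leb, forall x, vnorm V x <= M}%R.
  apply: filterS2 (Lnorm_oo_ae Vdelta) (H0s_vnorm_ae_support s0 hV).
  move=> x Vx VOx; have [Ox|Ox] := pselect (Omega x).
    move: Vx; rewrite /patch mem_set//= lee_fin ger0_norm ?vnorm_ge0// => Vx.
    exact: le_trans Vx deltaM.
  by apply: le_trans (ltW M0); rewrite leNgt; apply/negP => /VOx.
exists (4 * M)%R, ((4 * M)^-1)%R; split; first by rewrite mulr_gt0.
  by rewrite invr_gt0 mulr_gt0.
move=> W hW Wdelta; rewrite vnormBC.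
set T := 'N[leb]_1[_] => TM.
have mW i : measurable_fun setT (W i) by have [[]] := hW i.
have WM : {ae leb, forall x, vnorm W x <= M}%R.
  apply: filterS (Lnorm_oo_ae Wdelta) => x /=.
  by rewrite lee_fin ger0_norm ?vnorm_ge0// => /le_trans; exact.
have T0 : 0 <= T by exact: Lnorm_ge0.
have T_fin : T \is a fin_num.
  by rewrite ge0_fin_numE//; apply: le_lt_trans TM _; rewrite ltry.
pose t := fine T; have TE : T = t%:E by rewrite /t fineK.
have t0 : (0 <= t)%R by rewrite /t fine_ge0.
have tM : (2 * (2 * M * t) <= 1)%R.
  move: TM; rewrite TE lee_fin -[(_^-1)%R]mul1r ler_pdivlMr ?mulr_gt0//.
  by apply: le_trans; rewrite le_eqVlt; apply/orP; left; apply/eqP; ring.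
have Mt0 : (0 <= 2 * M * t)%R by rewrite !mulr_ge0// ltW.
pose kappa := (1 - 2 * M * t)%R.
have kappa0 : (0 < kappa)%R by rewrite /kappa; lra.
have Wk c : (kappa * \sum_i c i ^+ 2)%:E <= L2_norm2 (lincomb W c).
  have := L2_norm2_lincomb_le c mV mW VM WM (ltW M0).
  rewrite (L2_norm2_orthonormal c (fun i => H0s_Hs (hV i)) oV) -/T TE -EFinM.
  rewrite -leeBlDr//; apply: le_trans.
  rewrite -EFinB lee_fin le_eqVlt; apply/orP; left; apply/eqP.
  by rewrite /kappa; ring.
(* Test the minimality of Omega on the quasi-open support of W. *)
have [Om' [Om'D qo' hW' leb']] := H0s_quasi_open_support s0 Dopen hW.
rewrite (Hs_vseminorm2_eigenfunctions HV).
apply: (@le_trans _ _ (objective s m L Omega)).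
  apply: leeD => //; apply: lee_wpmul2l; first by rewrite lee_fin ltW.
  exact: le_leb_ae (H0s_vnorm_ae_support s0 hV).
apply: le_trans (Om_opt _ Om'D qo') _; apply: leeD; last first.
  by apply: lee_wpmul2l; first by rewrite lee_fin ltW.
apply: le_trans (sum_lambda_le s0 kappa0 hW' Wk) _.
apply: lee_wpmul2r.
  by apply: sume_ge0 => i _; exact: Hs_seminorm2_ge0.
rewrite TE -EFinM -EFinD lee_fin.
apply: le_trans (inv_1B_le Mt0 tM) _.
by rewrite le_eqVlt; apply/orP; left; apply/eqP; ring.
Qed.
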